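(* Let $d \ge 1$ be an integer, let $W \in \mathbb{R}^{d \times d}$ be a real matrix, and let $S = I_d - \frac{1}{d}\mathbf{1}\mathbf{1}^T \in \mathbb{R}^{d\times d}$, where $\mathbf{1} \in \mathbb{R}^d$ is the all-ones column vector. Let $\eta_1$ and $\eta_d$ be respectively the minimum and maximum singular values of $W$, and let $\kappa_1$ and $\kappa_d$ be respectively the minimum and maximum singular values of $SW$. Then $\eta_1 \ge \kappa_1$ and $\eta_d \ge \kappa_d$.
   Context: $I_d$ is the $d\times d$ identity matrix. The singular values of a real $d \times d$ matrix $P$ are the $d$ nonnegative square roots of the eigenvalues of $P^T P$, counted with multiplicity (so zero singular values are included). *)

(* Defs.v *)
From HB Require Import structures.
From mathcomp Require Import all_boot all_order all_algebra.
From mathcomp Require Import sesquilinear spectral polyrcf complex.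
From mathcomp Require Export reals.

Set Implicit Arguments.
Unset Strict Implicit.
Unset Printing Implicit Defensive.

Import Order.TTheory GRing.Theory Num.Theory.
Local Open Scope ring_scope.

(* Only the eigenvalues lying in R are listed; when A is symmetric these are all
   of them, see [char_poly_sym]. *)
Definition eigenvalue_seq (R : rcfType) (n : nat) (A : 'M[R]_n) : seq R :=
  flatten [seq nseq (mup x (char_poly A)) x | x <- rootsR (char_poly A)].

(* Sorted in nondecreasing order; by [size_singular_values] there are exactly
   d of them. *)
Definition singular_values (R : rcfType) (d : nat) (P : 'M[R]_d) : seq R :=
  sort <=%R [seq Num.sqrt a | a <- eigenvalue_seq (P^T *m P)].

(* In the next two definitions the default value 0 is reached only if d = 0. *)
Definition min_singular_value (R : rcfType) (d : nat) (P : 'M[R]_d) : R :=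
  head 0 (singular_values P).

Definition max_singular_value (R : rcfType) (d : nat) (P : 'M[R]_d) : R :=
  last 0 (singular_values P).

Definition ones (R : rcfType) (d : nat) : 'cV[R]_d := const_mx 1.

Definition centering_mx (R : rcfType) (d : nat) : 'M[R]_d :=
  1%:M - d%:R^-1 *: (ones R d *m (ones R d)^T).

Lemma eigenvalue_seq_perm (R : rcfType) (n : nat) (A : 'M[R]_n) (s : seq R) :
  char_poly A = \prod_(a <- s) ('X - a%:P) -> perm_eq (eigenvalue_seq A) s.
Proof.
move=> As; have A0 : char_poly A != 0 by rewrite monic_neq0 ?char_poly_monic.
have rootsE : perm_eq (rootsR (char_poly A)) (undup s).
  apply: uniq_perm; rewrite ?undup_uniq ?uniq_roots// => x.
  have := roots_on_rootsR A0 x; rewrite in_itv/= => <-.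
  by rewrite As root_prod_XsubC mem_undup.
apply: perm_trans (perm_count_undup s).
rewrite /eigenvalue_seq (eq_map (g := fun x => nseq (count_mem x s) x)).
  by apply: perm_flatten; apply: perm_map.
by move=> x; rewrite As mu_prod_XsubC.
Qed.

Lemma char_poly_conj (F : fieldType) (n : nat) (P D : 'M[F]_n) :
  P \in unitmx -> char_poly (invmx P *m D *m P) = char_poly D.
Proof.
move=> Pu; rewrite /char_poly.
have -> : char_poly_mx (invmx P *m D *m P) =
    map_mx polyC (invmx P) *m char_poly_mx D *m map_mx polyC P.
  rewrite /char_poly_mx mulmxBr mulmxBl -!map_mxM/=; congr (_ - _).
  by rewrite scalar_mxC -mulmxA -map_mxM mulVmx// map_mx1 mulmx1.
by rewrite !det_mulmx mulrAC -det_mulmx -map_mxM mulVmx// map_mx1 det1 mul1r.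
Qed.

Lemma char_poly_sym (R : rcfType) (n : nat) (A : 'M[R]_n) :
  A^T = A -> char_poly A = \prod_(a <- eigenvalue_seq A) ('X - a%:P).
Proof.
move=> Asym; pose f := real_complex R; pose B : 'M[R[i]]_n := map_mx f A.
have Bherm : B \is hermsymmx.
  apply: realsym_hermsym.
    apply/is_hermitianmxP; rewrite expr0 scale1r map_mx_id//.
    by rewrite /B map_trmx Asym.
  by apply/mxOverP => i j; rewrite mxE complex_real.
have /hermitian_normalmx/orthomx_spectralP Beq := Bherm.
have /mxOverP spr := hermitian_spectral_diag_real Bherm.
pose s := [seq complex.Re (spectral_diag B 0 i) | i <- enum 'I_n].
suff As : char_poly A = \prod_(a <- s) ('X - a%:P).
  by rewrite (perm_big _ (eigenvalue_seq_perm As)).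
apply: (@map_poly_inj _ _ f); rewrite map_char_poly -/B Beq.
rewrite char_poly_conj ?spectral_unit// char_poly_trig ?diag_mx_is_trig//.
rewrite rmorph_prod big_map big_enum/=; apply: eq_bigr => i _.
by rewrite rmorphB/= map_polyX map_polyC/= /f RRe_real// mxE eqxx mulr1n.
Qed.

Lemma size_singular_values (R : rcfType) (d : nat) (P : 'M[R]_d) :
  size (singular_values P) = d.
Proof.
rewrite size_sort size_map; apply/eqP; rewrite -eqSS.
rewrite -(size_prod_XsubC _ idfun) -char_poly_sym ?size_char_poly//.
by rewrite trmx_mul trmxK.
Qed.

(* Main.v *)
(** S is the orthogonal projection onto the complement of the all-ones vector,
    so |S W x| <= |W x| for every x. Take x to be a top right singular vector of
    S W: by the Rayleigh bound, kappa_d^2 |x|^2 = |S W x|^2 <= |W x|^2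
    <= eta_d^2 |x|^2. As S is singular, kappa_1 = 0, which settles the minima. *)
Require Import Defs.
From mathcomp Require Import all_boot all_order all_algebra reals.
From mathcomp Require Import sesquilinear spectral complex.
Set Implicit Arguments.
Unset Strict Implicit.
Unset Printing Implicit Defensive.
Import Order.TTheory GRing.Theory Num.Theory.
Local Open Scope ring_scope.

(** * Eigenvalues of symmetric matrices and the Rayleigh bound *)

Lemma mem_eigenvalue_seq (R : rcfType) (n : nat) (A : 'M[R]_n) (a : R) :
  A^T = A -> (a \in eigenvalue_seq A) = eigenvalue A a.
Proof.
move=> /char_poly_sym Ap.
by rewrite eigenvalue_root_char Ap root_prod_XsubC.
Qed.

Lemma gram_sym (R : comNzRingType) (m n : nat) (P : 'M[R]_(m, n)) :
  (P^T *m P)^T = P^T *m P.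
Proof. by rewrite trmx_mul trmxK. Qed.

Lemma sqnorm_rowE (R : comNzRingType) (n : nat) (x : 'rV[R]_n) :
  (x *m x^T) 0 0 = \sum_i x 0 i ^+ 2.
Proof. by rewrite mxE; apply: eq_bigr => i _; rewrite mxE. Qed.

Lemma sqnorm_row_gt0 (R : rcfType) (n : nat) (x : 'rV[R]_n) :
  x != 0 -> 0 < (x *m x^T) 0 0.
Proof.
move=> x0; rewrite sqnorm_rowE lt_def sumr_ge0 ?andbT; last first.
  by move=> i _; apply: sqr_ge0.
apply: contra x0 => /eqP s0; apply/eqP/rowP => i; rewrite mxE.
apply/eqP; rewrite -sqrf_eq0; apply/eqP.
by apply: (psumr_eq0P _ s0) => // j _; apply: sqr_ge0.
Qed.

Section Rayleigh.
Local Open Scope sesquilinear_scope.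

(** Over [R[i]] the spectral theorem writes [A] as [invmx P *m diag_mx D *m P] with [P] unitary. In
    the coordinates [y] of [x] with respect to [P], the two sides are the sums of [D 0 i * |y_i|^2]
    and of [M * |y_i|^2], which compare term by term. *)
Lemma rayleigh_le (R : rcfType) (n : nat) (A : 'M[R]_n) (M : R) (x : 'rV[R]_n) :
  A^T = A -> {in eigenvalue_seq A, forall a, a <= M} ->
  (x *m A *m x^T) 0 0 <= M * (x *m x^T) 0 0.
Proof.
move=> Asym leM; pose f := real_complex R; pose B : 'M[R[i]]_n := map_mx f A.
have Bherm : B \is hermsymmx.
  apply: realsym_hermsym.
    apply/is_hermitianmxP; rewrite expr0 scale1r map_mx_id//.
    by rewrite /B map_trmx Asym.
  by apply/mxOverP => i j; rewrite mxE complex_real.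
have /hermitian_normalmx/orthomx_spectralP := Bherm.
have /mxOverP := hermitian_spectral_diag_real Bherm.
have := spectral_unitarymx B.
move: (spectralmx B) (spectral_diag B) => P D Pu Dreal Beq.
(* Each diagonal entry is real and a root of the characteristic polynomial of [B], hence the image
   under [f] of an eigenvalue of [A]. *)
have DM i : D 0 i <= f M.
  have [a aD] : exists a, D 0 i = f a.
    by exists (complex.Re (D 0 i)); rewrite /f RRe_real.
  rewrite aD lecR; apply: leM; rewrite mem_eigenvalue_seq//.
  rewrite eigenvalue_root_char -(fmorph_root f) map_char_poly -/B Beq.
  rewrite char_poly_conj ?unitarymx_unit// char_poly_trig ?diag_mx_is_trig//.
  rewrite /root horner_prod (bigD1 i)//= hornerXsubC mxE eqxx mulr1n aD subrr.
  by rewrite mul0r.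
pose fx := map_mx f x; pose y := fx *m P^t*.
have fxT : map_mx f x^T = fx^t*.
  by apply/matrixP => i j; rewrite !mxE conj_Creal// complex_real.
have yT : y^t* = P *m fx^t*.
  by rewrite /y trmx_mul map_mxM/= trmxCK.
rewrite -lecR; have -> : ((x *m A *m x^T) 0 0)%:C%C = \sum_i D 0 i * `|y 0 i| ^+ 2.
  transitivity ((map_mx f (x *m A *m x^T)) 0 0); first by rewrite [RHS]mxE.
  rewrite !map_mxM -/B -/fx Beq fxT invmx_unitary// !mulmxA -/y -mulmxA -yT.
  rewrite mxE; apply: eq_bigr => i _.
  by rewrite mul_mx_diag !mxE normCK mulrA [_ * D _ _]mulrC.
have -> : (M * (x *m x^T) 0 0)%:C%C = \sum_i f M * `|y 0 i| ^+ 2.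
  rewrite -mulr_sumr rmorphM/=; congr (_ * _).
  transitivity ((map_mx f (x *m x^T)) 0 0); first by rewrite [RHS]mxE.
  (* A unitary change of coordinates preserves the norm. *)
  transitivity ((y *m y^t*) 0 0).
    rewrite yT /y mulmxA -[_ *m P^t* *m P]mulmxA -invmx_unitary//.
    by rewrite mulVmx ?unitarymx_unit// mulmx1 -fxT map_mxM.
  by rewrite mxE; apply: eq_bigr => i _; rewrite !mxE normCK.
by apply: ler_sum => i _; apply: ler_wpM2r => //; apply: exprn_ge0.
Qed.

End Rayleigh.

(** * Extreme singular values *)

Lemma singular_valuesP (R : rcfType) (d : nat) (P : 'M[R]_d) (s : R) :
  reflect (exists2 a, eigenvalue (P^T *m P) a & s = Num.sqrt a)
          (s \in singular_values P).
Proof.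
rewrite mem_sort; apply: (iffP mapP) => -[a].
  by rewrite mem_eigenvalue_seq ?gram_sym//; exists a.
by exists a; first rewrite mem_eigenvalue_seq ?gram_sym.
Qed.

Lemma min_singular_value_ge0 (R : rcfType) (d : nat) (P : 'M[R]_d) :
  0 <= min_singular_value P.
Proof.
rewrite /min_singular_value; case sP : (singular_values P) => [|s l] //=.
have /singular_valuesP[a _ ->] : s \in singular_values P.
  by rewrite sP mem_head.
exact: sqrtr_ge0.
Qed.

Lemma min_singular_value_le (R : rcfType) (d : nat) (P : 'M[R]_d) (s : R) :
  s \in singular_values P -> min_singular_value P <= s.
Proof.
rewrite /min_singular_value.
have : sorted <=%R (singular_values P) by apply: sort_le_sorted.
case: (singular_values P) => [|t l] //= /(order_path_min le_trans)/allP tl.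
by rewrite inE => /predU1P[->|/tl].
Qed.

Lemma le_max_singular_value (R : rcfType) (d : nat) (P : 'M[R]_d) (s : R) :
  s \in singular_values P -> s <= max_singular_value P.
Proof.
rewrite /max_singular_value.
have : sorted <=%R (singular_values P) by apply: sort_le_sorted.
case/lastP: (singular_values P) => [|l t] //= lt; rewrite last_rcons.
(* Reversing the list turns its last entry into the head of a nonincreasing list, which bounds the
   tail. *)
move: lt; rewrite -rev_sorted rev_rcons /=.
have ge_trans : transitive (fun x y : R => y <= x).
  by move=> y x z yx zy; apply: le_trans yx.
move=> /(order_path_min ge_trans)/allP tl.
by rewrite mem_rcons inE => /predU1P[->//|ls]; apply: tl; rewrite mem_rev.
Qed.

Lemma max_singular_value_in (R : rcfType) (d : nat) (P : 'M[R]_d) :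
  (0 < d)%N -> max_singular_value P \in singular_values P.
Proof.
rewrite -{1}(size_singular_values P) /max_singular_value.
by case: (singular_values P) => [|s l] //= _; apply: mem_last.
Qed.

Lemma max_singular_value_ge0 (R : rcfType) (d : nat) (P : 'M[R]_d) :
  0 <= max_singular_value P.
Proof.
rewrite /max_singular_value; case/lastP sP : (singular_values P) => [|l s] //=.
rewrite last_rcons; have /singular_valuesP[a _ ->] : s \in singular_values P.
  by rewrite sP mem_rcons mem_head.
exact: sqrtr_ge0.
Qed.

Lemma sqnorm_mul_le_max_singular_value (R : rcfType) (d : nat) (P : 'M[R]_d)
    (x : 'rV[R]_d) :
  (x *m (P^T *m P) *m x^T) 0 0 <= max_singular_value P ^+ 2 * (x *m x^T) 0 0.
Proof.
apply: rayleigh_le => [|a]; first exact: gram_sym.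
rewrite mem_eigenvalue_seq ?gram_sym// => aP.
(* [Num.sqrt] squares back to [a] only when [a] is nonnegative; for [a <= 0] any square is an upper
   bound. *)
have [a_le0|a_gt0] := leP a 0; first exact: le_trans (sqr_ge0 _).
rewrite -[leLHS]sqr_sqrtr ?(ltW a_gt0)// ler_pXn2r ?nnegrE ?sqrtr_ge0 ?max_singular_value_ge0//.
by apply: le_max_singular_value; apply/singular_valuesP; exists a.
Qed.

Lemma max_singular_value_contraction (R : rcfType) (d : nat) (S W : 'M[R]_d) :
  (forall y : 'rV[R]_d, (y *m (S^T *m S) *m y^T) 0 0 <= (y *m y^T) 0 0) ->
  max_singular_value (S *m W) <= max_singular_value W.
Proof.
move=> Sle; have [d0|d_gt0] := posnP d.
  (* For [d = 0] the list is empty and [last] returns its default 0. *)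
  have /size0nil sv0 : size (singular_values (S *m W)) = 0%N
    by rewrite size_singular_values.
  by rewrite {1}/max_singular_value sv0 max_singular_value_ge0.
have /singular_valuesP[a /eigenvalueP[x xa x0] ->] :=
  max_singular_value_in (S *m W) d_gt0.
(* Writing the right side as the square root of its square reduces the goal to a comparison of
   squares, which is then scaled by the positive [|x|^2]. *)
rewrite -[leRHS]ger0_norm ?max_singular_value_ge0// -sqrtr_sqr ler_wsqrtr//.
rewrite -(ler_pM2r (sqnorm_row_gt0 x0)).
apply: le_trans (sqnorm_mul_le_max_singular_value W x).
(* Eigenvectors are rows here, so [x *m W^T] is the transpose of [W] applied to the column [x^T],
   and the quadratic form of [S^T *m S] is evaluated at it. *)
have -> : a * (x *m x^T) 0 0 =
    (x *m W^T *m (S^T *m S) *m (x *m W^T)^T) 0 0.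
  transitivity ((x *m ((S *m W)^T *m (S *m W)) *m x^T) 0 0).
    by rewrite xa -scalemxAl [RHS]mxE.
  by rewrite !trmx_mul trmxK !mulmxA.
have -> : x *m (W^T *m W) *m x^T = (x *m W^T) *m (x *m W^T)^T.
  by rewrite trmx_mul trmxK !mulmxA.
exact: Sle.
Qed.

(** The Gram matrix is singular too, so 0 is one of its eigenvalues, and no singular value lies
    below 0. *)
Lemma min_singular_value_det0 (R : rcfType) (d : nat) (P : 'M[R]_d) :
  \det P = 0 -> min_singular_value P = 0.
Proof.
move=> P0; apply/eqP; rewrite eq_le min_singular_value_ge0 andbT.
apply: min_singular_value_le; apply/singular_valuesP.
exists 0; last by rewrite sqrtr0.
have /det0P[v v0 vP] : \det (P^T *m P) == 0 by rewrite det_mulmx P0 mulr0.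
by apply/eigenvalueP; exists v; rewrite // vP scale0r.
Qed.

(** * The centering matrix as an orthogonal projection *)

Lemma trmx_centering (R : rcfType) (d : nat) :
  (centering_mx R d)^T = centering_mx R d.
Proof.
by rewrite /centering_mx linearB linearZ/= trmx1 trmx_mul trmxK.
Qed.

Lemma ones_mul_centering (R : rcfType) (d : nat) :
  (ones R d)^T *m centering_mx R d = 0.
Proof.
have -> : (ones R d)^T *m centering_mx R d
    = (1 - d%:R^-1 * d%:R) *: (ones R d)^T.
  rewrite mulmxBr mulmx1 -scalemxAr mulmxA.
  have -> : (ones R d)^T *m ones R d = d%:R%:M.
    apply/matrixP => i j; rewrite !ord1 !mxE eqxx.
    under eq_bigr do rewrite !mxE mulr1.
    by rewrite sumr_const card_ord.
  by rewrite mul_scalar_mx scalerA scalerBl scale1r.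
(* For [d = 0] the scalar [1 - d%:R^-1 * d%:R] is 1 and not 0, but the row has no entries. *)
case: d => [|d]; first by apply/matrixP => i [].
by rewrite mulVf ?pnatr_eq0// subrr scale0r.
Qed.

Lemma centering_mx_idem (R : rcfType) (d : nat) :
  centering_mx R d *m centering_mx R d = centering_mx R d.
Proof.
rewrite {1}/centering_mx mulmxBl mul1mx -scalemxAl -mulmxA.
by rewrite ones_mul_centering mulmx0 scaler0 subr0.
Qed.

Lemma det_centering (R : rcfType) (d : nat) :
  (0 < d)%N -> \det (centering_mx R d) = 0.
Proof.
case: d => // d _; apply/eqP/det0P; exists (ones R d.+1)^T.
  apply/eqP => /matrixP/(_ 0 0); rewrite !mxE.
  exact/eqP/oner_neq0.
exact: ones_mul_centering.
Qed.

(** As [S] is symmetric and idempotent, the left side is [y *m S *m y^T], that is [|y|^2] minus the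
    square of the sum of the entries of [y] divided by [d]. *)
Lemma centering_contraction (R : rcfType) (d : nat) (y : 'rV[R]_d) :
  let S := centering_mx R d in
  (y *m (S^T *m S) *m y^T) 0 0 <= (y *m y^T) 0 0.
Proof.
rewrite /= trmx_centering centering_mx_idem /centering_mx.
rewrite mulmxBr mulmx1 mulmxBl -scalemxAr -scalemxAl.
have -> : y *m (ones R d *m (ones R d)^T) *m y^T
    = (y *m ones R d) *m (y *m ones R d)^T by rewrite trmx_mul !mulmxA.
rewrite [leLHS]mxE gerDl mxE oppr_le0 mxE.
by rewrite mulr_ge0 ?invr_ge0 ?ler0n// sqnorm_rowE sumr_ge0// => i _; apply: sqr_ge0.
Qed.

Theorem theorem1 (R : realType) (d : nat) (d_ge1 : (1 <= d)%N) (W : 'M[R]_d) :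
  let S := centering_mx R d in
  let eta_1 := min_singular_value W in
  let eta_d := max_singular_value W in
  let kappa_1 := min_singular_value (S *m W) in
  let kappa_d := max_singular_value (S *m W) in
  eta_1 >= kappa_1 /\ eta_d >= kappa_d.
Proof.
move=> S eta_1 eta_d kappa_1 kappa_d; split.
  rewrite /kappa_1 min_singular_value_det0; first exact: min_singular_value_ge0.
  by rewrite det_mulmx det_centering// mul0r.
exact/max_singular_value_contraction/centering_contraction.
Qed.
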